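(* Let $G$ be an infinite finitely generated group and let $\sigma\colon \mathbb{N}_0 \to [1,\infty)$ be an almost submultiplicative growth function with $(1+n) \preccurlyeq \sigma$. Then the Fréchet space $\mathcal{A}_\sigma(G)$ is nuclear if and only if $\beta_G \preccurlyeq \sigma$.
   Context: Fix a finite generating set $S = S^{-1}$ of $G$; the word length $L(g)\in\mathbb{N}_0$ is the minimal number of elements of $S$ needed to write $g$ as a product, with $L(e)=0$. The volume growth is $\beta_G(n) = \#\{g\in G : L(g)\le n\}$. A growth function is a map $\sigma\colon\mathbb{N}_0\to[1,\infty)$ that is monotonically increasing ($\sigma(n)\le\sigma(n+1)$) and unbounded. It is almost submultiplicative if for every $\epsilon>0$ there is $c>0$ with $\sigma(n+m)\le c\,\sigma(n)^{1+\epsilon}\sigma(m)^{1+\epsilon}$ for all $n,m\in\mathbb{N}_0$. For maps $\sigma,\sigma'\colon\mathbb{N}_0\to[1,\infty)$ write $\sigma\preccurlyeq\sigma'$ if there are an integer $c\ge1$ and a real $k\ge1$ with $\sigma(n)\le c\,\sigma'(cn)^k$ for all $n\in\mathbb{N}_0$; $(1+n)$ denotes the function $n\mapsto 1+n$. $\mathbb{C}[[G]]$ is the vector space of all formal series $a=\sum_{g\in G}a_g\mathsf{e}_g$ with arbitrary $a_g\in\mathbb{C}$. For $R\ge0$ put $\|a\|_{L,\sigma,R}=\sum_{g\in G}|a_g|\,\sigma(L(g))^R\in[0,\infty]$. Then $\mathcal{A}_\sigma(G)=\{a\in\mathbb{C}[[G]] : \|a\|_{L,\sigma,R}<\infty \text{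 for all } R\ge0\}$, with the locally convex topology defined by all norms $\|\cdot\|_{L,\sigma,R}$, $R\ge0$ (this space and topology do not depend on the choice of $S$). Nuclear means nuclear as a locally convex space in the sense of Grothendieck. *)

(* Defs.v *)
From HB Require Import structures.
From mathcomp Require Import all_boot all_order all_algebra finmap.
From mathcomp Require Import all_classical all_reals all_analysis.
From mathcomp Require Import complex.

Set Implicit Arguments.
Unset Strict Implicit.
Unset Printing Implicit Defensive.

Import Order.TTheory GRing.Theory Num.Theory.
Import numFieldNormedType.Exports.

Local Open Scope classical_set_scope.
Local Open Scope complex_scope.
Local Open Scope ring_scope.

(* In MathComp-Analysis the norm of a normed module over [R[i]] takes its
   values in [R[i]]; [rnorm] is the same norm, read as a real number. *)
Definition rnorm (R : realType) (V : normedZmodType R[i]) (x : V) : R :=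
  complex.Re `|x|.

Section RnormTheory.
Variables (R : realType) (V : normedZmodType R[i]).
Implicit Types (x y : V).

Lemma rnormE x : (rnorm x)%:C = `|x|.
Proof. by rewrite RRe_real// normr_real. Qed.

Lemma rnorm_ge0 x : 0 <= rnorm x.
Proof. by rewrite -ler0c rnormE. Qed.

Lemma rnormD x y : rnorm (x + y) <= rnorm x + rnorm y.
Proof. by rewrite -lecR rmorphD/= !rnormE ler_normD. Qed.

Lemma rnorm0 : rnorm (0 : V) = 0.
Proof. by rewrite /rnorm normr0. Qed.

End RnormTheory.

Lemma rnormM (R : realType) (a b : R[i]) : rnorm (a * b) = rnorm a * rnorm b.
Proof. by apply: (@complexI R); rewrite rmorphM/= !rnormE normrM. Qed.

Record seminorm (R : realType) (E : lmodType R[i]) := Seminorm {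
  seminorm_fun :> E -> R ;
  seminormD : forall x y,
    seminorm_fun (x + y) <= seminorm_fun x + seminorm_fun y ;
  seminormZ : forall (a : R[i]) x,
    seminorm_fun (a *: x) = rnorm a * seminorm_fun x }.

Section SeminormTheory.
Variables (R : realType) (E : lmodType R[i]) (p : seminorm E).

Lemma seminorm0 : p 0 = 0.
Proof. by rewrite -(scale0r 0) seminormZ rnorm0 mul0r. Qed.

Lemma seminormN x : p (- x) = p x.
Proof. by rewrite -scaleN1r seminormZ /rnorm normrN normr1/= mul1r. Qed.

Lemma seminorm_ge0 x : 0 <= p x.
Proof.
rewrite -(pmulrn_lge0 _ (isT : (0 < 2)%N)) mulr2n -{2}seminormN.
by rewrite -seminorm0 -(subrr x) seminormD.
Qed.

End SeminormTheory.

(* [seminorm_topology p] is [E] with the locally convex topology defined by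
   the family of seminorms [p]. *)
Definition seminorm_topology (R : realType) (E : lmodType R[i]) (I : Type)
  (p : I -> seminorm E) : Type := E.

Section SeminormTopology.
Variables (R : realType) (E : lmodType R[i]) (I : Type) (p : I -> seminorm E).
Local Notation T := (seminorm_topology p).

HB.instance Definition _ := GRing.Lmodule.on T.

Definition sball (s : seq I) (x : T) (e : R) : set T :=
  [set y | all (fun i => p i (y - x) < e) s].

Definition seminorm_nbhs (x : T) : set_system T :=
  [set U | exists (s : seq I) (e : R), 0 < e /\ sball s x e `<=` U].

HB.instance Definition _ := hasNbhs.Build T seminorm_nbhs.

Let sballxx s x e : 0 < e -> sball s x e x.
Proof.
by move=> e0; rewrite /sball/=; apply/allT => i; rewrite subrr seminorm0.
Qed.

Let sball_le s x e e' : e <= e' -> sball s x e `<=` sball s x e'.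
Proof. by move=> ee' y; apply: sub_all => i /lt_le_trans; apply. Qed.

Let sballD s x y z e e' :
  sball s x e y -> sball s y e' z -> sball s x (e + e') z.
Proof.
rewrite /sball/=; elim: s => //= i s IHs /andP[xy sxy] /andP[yz syz].
rewrite IHs// andbT.
have -> : z - x = (y - x) + (z - y) by rewrite [RHS]addrC addrA subrK.
by rewrite (le_lt_trans (seminormD _ _ _))// ltrD.
Qed.

Let sball_inner s x y e : 0 < e -> sball s x e y ->
  exists2 d, 0 < d & sball s y d `<=` sball s x e.
Proof.
move=> e0 xy; suff [d [d0 de dy]] : exists d, [/\ 0 < d, d < e & sball s x d y].
  exists (e - d); first by rewrite subr_gt0.
  by move=> z /(sballD dy); rewrite addrC subrK.
move: xy; rewrite /sball/=; elim: s => [|i s IHs] /=.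
  by exists (e / 2); rewrite divr_gt0// ltr_pdivrMr// mulr_natr mulr2n ltrDl.
move=> /andP[xy /IHs[d [d0 de dy]]].
exists (Num.max d ((p i (y - x) + e) / 2)); split.
- by rewrite lt_max d0.
- by rewrite gt_max de/= ltr_pdivrMr// mulr_natr mulr2n ltrD2r.
- apply/andP; split.
    by rewrite lt_max ltr_pdivlMr// mulr_natr mulr2n ltrD2l xy orbT.
  by apply: sub_all dy => j /lt_le_trans; apply; rewrite le_max lexx.
Qed.

Let nbhs_sball s x e : 0 < e -> nbhs x (sball s x e).
Proof. by move=> e0; rewrite /nbhs/=; exists s, e; split. Qed.

Let seminorm_nbhs_filter (x : T) : ProperFilter (nbhs x).
Proof.
split; first by move=> [s [e [e0 /(_ x)]]]; apply; exact: sballxx.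
split; first by exists [::], 1.
- move=> U V [s [e [e0 sU]]] [t [d [d0 tV]]].
  exists (s ++ t), (Num.min e d); split; first by rewrite lt_min e0.
  move=> y; rewrite /sball/= all_cat => /andP[sy ty].
  split; [apply: sU|apply: tV].
    by apply: sball_le sy; rewrite ge_min lexx.
  by apply: sball_le ty; rewrite ge_min lexx orbT.
- by move=> U V UV [s [e [e0 sU]]]; exists s, e; split=> //; exact: subset_trans UV.
Qed.

Let seminorm_nbhs_singleton (x : T) (U : set T) : nbhs x U -> U x.
Proof. by move=> [s [e [e0]]]; apply; exact: sballxx. Qed.

Let seminorm_nbhs_nbhs (x : T) (U : set T) : nbhs x U -> nbhs x (nbhs^~ U).
Proof.
move=> [s [e [e0 sU]]]; exists s, e; split=> // y /(sball_inner e0)[d d0 dU].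
by exists s, d; split=> //; exact: subset_trans sU.
Qed.

HB.instance Definition _ := Nbhs_isNbhsTopological.Build T
  seminorm_nbhs_filter seminorm_nbhs_singleton seminorm_nbhs_nbhs.

Let seminorm_add_continuous : continuous (fun x : T * T => x.1 + x.2).
Proof.
move=> [x y] U [s [e [e0 sU]]] /=.
exists (sball s x (e / 2), sball s y (e / 2)).
  by split; apply: nbhs_sball; rewrite divr_gt0.
move=> [x' y'] /= [sx sy]; apply: sU; move: sx sy; rewrite /sball/=.
move=> sx sy; elim: s sx sy => //= i s IHs /andP[ix sx] /andP[iy sy].
rewrite IHs// andbT opprD addrACA (le_lt_trans (seminormD _ _ _))//.
by rewrite [ltRHS]splitr ltrD.
Qed.

Let sball_bound (s : seq I) (x : T) :
  exists2 M : R, 0 < M & all (fun i => p i x <= M) s.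
Proof.
elim: s => [|i s [M M0 sM]]; first by exists 1.
exists (Num.max (p i x) M); first by rewrite lt_max M0 orbT.
rewrite /= le_max lexx/=; apply: sub_all sM => j /le_trans; apply.
by rewrite le_max lexx orbT.
Qed.

Let seminorm_scale_continuous :
  continuous (fun z : (R[i])^o * T => z.1 *: z.2).
Proof.
move=> [k x] U [s [e [e0 sU]]] /=; have [M M0 sM] := sball_bound s x.
pose d := Num.min 1 (e / 2 / M); pose c := e / 2 / (rnorm k + 1).
have d0 : 0 < d by rewrite lt_min ltr01 !divr_gt0.
have k1 : 0 < rnorm k + 1 by rewrite ltr_wpDl// rnorm_ge0.
have c0 : 0 < c by rewrite !divr_gt0.
exists (ball (k : (R[i])^o) d%:C, sball s x c).
  by split; [apply: nbhsx_ballx; rewrite -[0]/(0%:C) ltcR|exact: nbhs_sball].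
move=> [l y] /= [kl sy]; apply: sU.
have {}kl : rnorm (l - k) < d.
  by move: kl; rewrite -ball_normE/= distrC -ltcR rnormE.
have lk : rnorm l < rnorm k + 1.
  rewrite -(subrK k l) addrC (le_lt_trans (rnormD _ _))// ltrD2l.
  by rewrite (lt_le_trans kl)// ge_min lexx.
move: sM sy; rewrite /sball/=; elim: s => //= i s IHs /andP[ix sx] /andP[iy sy].
rewrite IHs// andbT.
have -> : l *: y - k *: x = l *: (y - x) + (l - k) *: x.
  by rewrite scalerBr scalerBl addrA subrK.
rewrite (le_lt_trans (seminormD _ _ _))// !seminormZ [ltRHS]splitr ltr_leD//.
  rewrite (@le_lt_trans _ _ ((rnorm k + 1) * p i (y - x)))//.
    by rewrite ler_wpM2r ?seminorm_ge0// ltW.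
  by rewrite mulrC -ltr_pdivlMr.
rewrite (@le_trans _ _ (d * M))//.
  by rewrite ler_pM ?rnorm_ge0 ?seminorm_ge0// ltW.
by rewrite -ler_pdivlMr// ge_min lexx orbT.
Qed.

Let sball_convex (s : seq I) (x : T) (e : R) : convex_set (sball s x e).
Proof.
apply/convex_setW => y z; rewrite !inE => sy sz l l0 l1; rewrite inE.
set m : R[i] := l%:num in l0 l1 *.

have m1 : 0 < 1 - m by rewrite subr_gt0.
have pos (a : R[i]) : 0 < a -> 0 < rnorm a.
  by move=> a0; rewrite -ltcR rnormE normr_gt0 gt_eqF.
have rD : rnorm m + rnorm (1 - m) = 1.
  apply: (@complexI R); rewrite rmorphD/= !rnormE !gtr0_norm//.
  by rewrite addrC subrK.
move: sy sz; rewrite /sball/=.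
elim: s => //= i s IHs /andP[iy sy] /andP[iz sz]; rewrite IHs// andbT.
rewrite [X in p i X](_ : _ = m *: (y - x) + (1 - m) *: (z - x)); last first.
  rewrite !scalerBr addrACA -opprD -scalerDl (addrC m) subrK scale1r.
  by rewrite /conv/=.
rewrite (le_lt_trans (seminormD _ _ _))// !seminormZ.
by rewrite -(mul1r e) -rD mulrDl ltrD// ltr_pM2l// pos.
Qed.

Let seminorm_locally_convex : exists2 B : set_system T,
  (forall b, b \in B -> convex_set b) & basis B.
Proof.
exists [set b | exists s x e, 0 < e /\ b = sball s x e].
  by move=> b; rewrite inE => -[s [x [e [_ ->]]]]; exact: sball_convex.
split.
  move=> _ [s [x [e [e0 ->]]]]; rewrite openE => y /(sball_inner e0)[d d0 dU].
  by exists s, d.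
move=> x U [s [e [e0 sU]]]; exists (sball s x e) => //=; split.
  by exists s, x, e.
exact: sballxx.
Qed.

HB.instance Definition _ := PreTopologicalLmod_isTvs.Build R[i] T
  seminorm_add_continuous seminorm_scale_continuous seminorm_locally_convex.
HB.instance Definition _ :=
  PreTopologicalNmodule_isTopologicalNmodule.Build T seminorm_add_continuous.
HB.instance Definition _ :=
  TopologicalNmodule_isTopologicalLmodule.Build R[i] T
    seminorm_scale_continuous.
HB.instance Definition _ := Uniform_isTvs.Build R[i] T seminorm_locally_convex.

End SeminormTopology.

(* [j : E -> B] exhibits the Banach space [B] as the completion of the normed
   space [E / ker p], i.e. as the local Banach space of [E] at [p]; this
   determines [B] up to isometric isomorphism. *)
Definition is_local_banach (R : realType) (E : lmodType R[i]) (p : seminorm E)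
    (B : completeNormedModType R[i]) (j : {linear E -> B}) : Prop :=
  (forall x, rnorm (j x) = p x) /\ dense (range j).

Definition dual_norm (R : realType) (E : normedModType R[i])
    (f : {linear E -> (R[i])^o}) : \bar R :=
  ereal_sup [set (rnorm (f x))%:E | x in [set x | rnorm x <= 1]].

Definition nuclear_map (R : realType) (E F : completeNormedModType R[i])
    (u : {linear E -> F}) : Prop :=
  exists (f : nat -> {linear E -> (R[i])^o}) (y : nat -> F),
    [/\ forall n, continuous (f n),
        (\sum_(n <oo) (dual_norm (f n) * (rnorm (y n))%:E) < +oo)%E
      & forall x, series (fun n => f n x *: y n) @ \oo --> u x].

(* [u] below is the canonical map between local Banach spaces induced by the
   identity of [E]. *)
Definition nuclear_space (R : realType) (E : tvsType R[i]) : Prop :=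
  forall p : seminorm E, continuous p ->
  exists q : seminorm E,
    [/\ continuous q, forall x, p x <= q x
      & exists (Eq Ep : completeNormedModType R[i])
          (jq : {linear E -> Eq}) (jp : {linear E -> Ep})
          (u : {linear Eq -> Ep}),
          [/\ is_local_banach q jq, is_local_banach p jp, continuous u,
              forall x, u (jq x) = jp x & nuclear_map u]].

Definition symmetric_generating (G : groupType) (S : {fset G}) : Prop :=
  (forall s, s \in S -> (s^-1)%g \in S) /\
  (forall g : G, exists2 w : seq G, {subset w <= S} & g = (\prod_(s <- w) s)%g).

Definition is_word (G : groupType) (S : {fset G}) (g : G) (n : nat) : Prop :=
  exists w : seq G, [/\ size w = n, {subset w <= S} & g = (\prod_(s <- w) s)%g].

(* The value is 0 when [g] is not a product of elements of [S]; this does not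
   happen when [S] generates. *)
Definition word_length (G : groupType) (S : {fset G}) (g : G) : nat :=
  match pselect (exists n, `[< is_word S g n >]) with
  | left ex_n => ex_minn ex_n
  | right _ => 0%N
  end.

Definition volume_growth (R : realType) (G : groupType) (S : {fset G})
    (n : nat) : R :=
  #|` fset_set [set g : G | (word_length S g <= n)%N]|%:R.

Definition growth_function (R : realType) (sigma : nat -> R) : Prop :=
  [/\ forall n, 1 <= sigma n,
      forall n, sigma n <= sigma n.+1
    & forall M : R, exists n, M < sigma n].

Definition almost_submultiplicative (R : realType) (sigma : nat -> R) : Prop :=
  forall eps : R, 0 < eps -> exists2 c : R, 0 < c & forall n m : nat,
    sigma (n + m)%N <= c * sigma n `^ (1 + eps) * sigma m `^ (1 + eps).

Definition preceq (R : realType) (sigma sigma' : nat -> R) : Prop :=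
  exists (c : nat) (k : R), [/\ (1 <= c)%N, 1 <= k
    & forall n, sigma n <= c%:R * sigma' (c * n)%N `^ k].

Section RapidDecay.
Variables (R : realType) (G : groupType) (S : {fset G}) (sigma : nat -> R).
Implicit Types (a b : G -> R[i]) (r : R).

Definition wnorm r a : \bar R :=
  (\esum_(g in [set: G]) (rnorm (a g) * sigma (word_length S g) `^ r)%:E)%E.

Definition rapid_decay : {pred G -> R[i]} :=
  fun a => `[< forall r, 0 <= r -> (wnorm r a < +oo)%E >].

Let term_ge0 r a g :
  (0 <= (rnorm (a g) * sigma (word_length S g) `^ r)%:E)%E.
Proof. by rewrite lee_fin mulr_ge0 ?rnorm_ge0 ?powR_ge0. Qed.

Lemma wnorm_ge0 r a : (0 <= wnorm r a)%E.
Proof. by apply: esum_ge0 => g _; exact: term_ge0. Qed.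

Lemma wnormD r a b : (wnorm r (a + b)%R <= wnorm r a + wnorm r b)%E.
Proof.
rewrite /wnorm -esumD; [|by move=> *; exact: term_ge0..].
apply: le_esum => g _; rewrite -EFinD lee_fin -mulrDl ler_wpM2r ?powR_ge0//.
exact: rnormD.
Qed.

Let wnormZ_le r (k : R[i]) a : (wnorm r (k *: a)%R <= (rnorm k)%:E * wnorm r a)%E.
Proof.
apply: ge_ereal_sup => _ [X [finX _] <-].
under eq_fsbigr => g _ do rewrite rnormM -mulrA EFinM.
rewrite -ge0_mule_fsumr; last by move=> g; exact: term_ge0.
rewrite lee_wpmul2l ?lee_fin ?rnorm_ge0//.
by apply: ereal_sup_ubound; exists X => //; split.
Qed.

Lemma wnormZ r (k : R[i]) a : wnorm r (k *: a) = ((rnorm k)%:E * wnorm r a)%E.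
Proof.
apply/eqP; rewrite eq_le wnormZ_le/=.
have [->|k0] := eqVneq k 0; first by rewrite rnorm0 mul0e wnorm_ge0.
have rk : rnorm k != 0.
  by apply: contra_neq k0 => rk; apply/normr0_eq0; rewrite -rnormE rk.
have := wnormZ_le r k^-1 (k *: a).
rewrite scalerA mulVf// scale1r => h.
rewrite (@le_trans _ _ ((rnorm k)%:E * ((rnorm k^-1)%:E * wnorm r (k *: a))))%E//.
  by rewrite lee_wpmul2l ?lee_fin ?rnorm_ge0.
rewrite muleA -EFinM -rnormM mulfV//.
by rewrite /rnorm normr1/= mul1e.
Qed.

Lemma rapid_decay_closed : submod_closed rapid_decay.
Proof.
split=> [|k a b /asboolP fa /asboolP fb]; apply/asboolP => r r0.
  by rewrite -(scale0r 0) wnormZ rnorm0 mul0e.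
rewrite (le_lt_trans (wnormD _ _ _))// lte_add_pinfty ?fb// wnormZ.
by rewrite lte_mul_pinfty ?lee_fin ?rnorm_ge0 ?fa.
Qed.

HB.instance Definition _ :=
  GRing.isSubmodClosed.Build R[i] (G -> R[i]) rapid_decay rapid_decay_closed.

Record rapid_decay_series : Type := RapidDecaySeries {
  coef :> G -> R[i] ; _ : coef \in rapid_decay }.

HB.instance Definition _ := [isSub for coef].
HB.instance Definition _ := [Choice of rapid_decay_series by <:].
HB.instance Definition _ :=
  [SubChoice_isSubLmodule of rapid_decay_series by <:].

Lemma wnorm_fin (r : {nonneg R}) (a : rapid_decay_series) :
  wnorm r%:num a \is a fin_num.
Proof.
case: a => a ia; rewrite ge0_fin_numE ?wnorm_ge0//=.
by move/asboolP: ia; exact.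
Qed.

Let rwnorm (r : {nonneg R}) (a : rapid_decay_series) : R :=
  fine (wnorm r%:num a).

Let rwnormD (r : {nonneg R}) (a b : rapid_decay_series) :
  rwnorm r (a + b) <= rwnorm r a + rwnorm r b.
Proof.
rewrite -lee_fin EFinD !fineK ?wnorm_fin//; exact: wnormD.
Qed.

Let rwnormZ (r : {nonneg R}) (k : R[i]) (a : rapid_decay_series) :
  rwnorm r (k *: a) = rnorm k * rwnorm r a.
Proof.
by apply: EFin_inj; rewrite EFinM !fineK ?wnorm_fin// -wnormZ.
Qed.

Definition wseminorm (r : {nonneg R}) : seminorm rapid_decay_series :=
  Seminorm (rwnormD r) (rwnormZ r).

Definition A_sigma : Type := seminorm_topology wseminorm.

HB.instance Definition _ := Tvs.on A_sigma.

End RapidDecay.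

(* Main.v *)
Require Import Defs.
From HB Require Import structures.
From mathcomp Require Import all_boot all_order all_algebra finmap.
From mathcomp Require Import all_classical all_reals all_analysis.
From mathcomp Require Import complex ring_quotient generic_quotient ring lra.

(** Grothendieck-Pietsch: the space is nuclear iff the inverse weights
    [sigma (L g) ^- r] are summable over [G] for some [r].
    If they are, a continuous seminorm [p] is dominated by some
    [C * |_|_r], and the map from the local Banach space of [C * |_|_(r+m)] to
    that of [p] is the sum over [g] of (coordinate at [g]) times (image of
    [e_g]), with summands of norm at most [sigma (L g) ^- m].  Conversely, the
    trace of a nuclear map between the local Banach spaces of [|_|_r] and
    [|_|_0] bounds the sum of the inverse weights.
    On balls, summability gives [beta n <= M * sigma n ^ r]; conversely, with
    [beta n <= C1 * sigma n ^ K1] and [1 + n <= C2 * sigma n ^ K2] the exponent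
    [K1 + 2 K2] makes the series converge like the sum of [(1 + n) ^ -2].
    Almost submultiplicativity absorbs the dilation in [preceq]. *)

Set Implicit Arguments.
Unset Strict Implicit.
Unset Printing Implicit Defensive.

Import Order.TTheory GRing.Theory Num.Theory.
Import numFieldNormedType.Exports.

Local Open Scope classical_set_scope.
Local Open Scope complex_scope.
Local Open Scope ring_scope.
Local Open Scope quotient_scope.

(** * Completion of a seminormed space *)

Lemma inv_succ_lt (R : realType) (e : R) : 0 < e ->
  exists N, forall n, (N <= n)%N -> n.+1%:R^-1 < e.
Proof. by move=> e0; have [N _ h] := near_infty_natSinv_lt (PosNum e0); exists N. Qed.

Section SeminormDist.
Variables (R : realType) (E : lmodType R[i]) (p : seminorm E).

Lemma seminormB_sym x y : p (x - y) = p (y - x).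
Proof. by rewrite -seminormN opprB. Qed.

Lemma seminorm_dist x y : `|p x - p y| <= p (x - y).
Proof.
rewrite ler_norml; apply/andP; split.
  rewrite lerNl opprB lerBlDr seminormB_sym.
  by rewrite (le_trans _ (seminormD _ _ _))// subrK.
by rewrite lerBlDr (le_trans _ (seminormD _ _ _))// subrK.
Qed.

End SeminormDist.

Section Completion.
Variables (R : realType) (E : lmodType R[i]) (p : seminorm E).

Definition cauchy_sequence : {pred nat -> E} := fun s =>
  `[< forall e, 0 < e -> exists N, forall m n,
      (N <= m)%N -> (N <= n)%N -> p (s m - s n) < e >].

Lemma cauchy_sequence_closed : submod_closed cauchy_sequence.
Proof.
split=> [|k s t /asboolP cs /asboolP ct]; apply/asboolP => e e0.
  by exists 0%N => m n _ _; rewrite subrr seminorm0.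
have k0 : 0 < rnorm k + 1 by rewrite ltr_wpDl// rnorm_ge0.
have [N1 h1] := cs (e / 2 / (rnorm k + 1)) ltac:(by rewrite !divr_gt0).
have [N2 h2] := ct (e / 2) ltac:(by rewrite divr_gt0).
exists (maxn N1 N2) => m n; rewrite !geq_max => /andP[m1 m2] /andP[n1 n2].
rewrite [X in p X](_ : _ = k *: (s m - s n) + (t m - t n)); last first.
  by rewrite scalerBr addrACA -opprD.
rewrite (le_lt_trans (seminormD _ _ _))// seminormZ [ltRHS]splitr ler_ltD ?h2//.
have := ltW (h1 _ _ m1 n1); rewrite ler_pdivlMr// mulrC => /(le_trans _); apply.
by rewrite ler_wpM2r ?seminorm_ge0// lerDl.
Qed.

HB.instance Definition _ := GRing.isSubmodClosed.Build R[i] (nat -> E)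
  cauchy_sequence cauchy_sequence_closed.

Record cauchy_seqs : Type := CauchySeq {
  cseq :> nat -> E ; _ : cseq \in cauchy_sequence }.

HB.instance Definition _ := [isSub for cseq].
HB.instance Definition _ := [Choice of cauchy_seqs by <:].
HB.instance Definition _ := [SubChoice_isSubLmodule of cauchy_seqs by <:].

Lemma cseqP (s : cauchy_seqs) e : 0 < e -> exists N, forall m n,
  (N <= m)%N -> (N <= n)%N -> p (s m - s n) < e.
Proof. by case: s => s /= /asboolP; exact. Qed.

Lemma is_cvg_cseq (s : cauchy_seqs) : cvgn (fun n => p (s n)).
Proof.
apply/cauchy_cvgP/cauchy_ballP => e e0; have [N sN] := cseqP s e0.
exists ([set x | exists2 n, (N <= n)%N & x = p (s n)],
        [set x | exists2 n, (N <= n)%N & x = p (s n)]) => /=.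
  by split; exists N => // n /= Nn; exists n.
move=> [_ _] [/= [m Nm ->] [n Nn ->]].
by rewrite /ball/= (le_lt_trans (seminorm_dist _ _ _))// sN.
Qed.

Definition cnorm (s : cauchy_seqs) : R := limn (fun n => p (s n)).

Lemma cnormD s t : cnorm (s + t) <= cnorm s + cnorm t.
Proof.
rewrite /cnorm -limD; [|exact: is_cvg_cseq..].
apply: ler_lim; [exact: is_cvg_cseq|apply: is_cvgD; exact: is_cvg_cseq|].
by apply: nearW => n; exact: seminormD.
Qed.

Lemma cnormZ (k : R[i]) s : cnorm (k *: s) = rnorm k * cnorm s.
Proof.
apply/cvg_lim => //; under eq_fun => n do rewrite /= seminormZ.
by apply: cvgM; [exact: cvg_cst|exact: is_cvg_cseq].
Qed.

Definition cseminorm := Seminorm cnormD cnormZ.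

Lemma cnorm_le (s : cauchy_seqs) (M : R) :
  (exists N, forall n, (N <= n)%N -> p (s n) <= M) -> cnorm s <= M.
Proof.
move=> [N sN]; apply: limr_le; first exact: is_cvg_cseq.
by exists N.
Qed.

Definition null_seqs : {pred cauchy_seqs} := fun s => cseminorm s == 0.

Lemma null_seqs_closed : zmod_closed null_seqs.
Proof.
split=> [|s t]; rewrite !unfold_in; first by rewrite seminorm0.
move=> /eqP s0 /eqP t0; rewrite eq_le seminorm_ge0 andbT.
by rewrite (le_trans (seminormD _ _ _))// seminormN s0 t0 addr0.
Qed.

HB.instance Definition _ := GRing.isZmodClosed.Build cauchy_seqs null_seqs
  null_seqs_closed.

(** Cauchy sequences modulo those of limit seminorm 0. The same quotient identifies points of [E] at
    [p]-distance 0, so this completes [E / ker p]. *)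
Definition completion : Type := Quotient.quot null_seqs.

HB.instance Definition _ := GRing.Zmodule.on completion.

Definition cpi (s : cauchy_seqs) : completion := \pi_(Quotient.quot null_seqs) s.

Lemma cpiK (x : completion) : cpi (repr x) = x.
Proof. exact: reprK. Qed.

Lemma cpiD s t : cpi (s + t) = cpi s + cpi t.
Proof. by rewrite /cpi raddfD. Qed.

Lemma cpiB s t : cpi (s - t) = cpi s - cpi t.
Proof. by rewrite /cpi raddfB. Qed.

Lemma cpi_eq s t : cseminorm (s - t) = 0 <-> cpi s = cpi t.
Proof.
split=> h; first by apply/eqP; rewrite -Quotient.idealrBE unfold_in h.
by move/eqP: h; rewrite -Quotient.idealrBE unfold_in => /eqP.
Qed.

Lemma cpi_surj x : exists s, x = cpi s.
Proof. by exists (repr x); rewrite cpiK. Qed.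

Lemma cseminorm_repr s : cseminorm (repr (cpi s)) = cseminorm s.
Proof.
have h : cseminorm (repr (cpi s) - s) = 0 by apply/cpi_eq; rewrite cpiK.
apply/eqP; rewrite -subr_eq0 -normr_le0 -h; exact: seminorm_dist.
Qed.

Definition completion_scale (k : R[i]) (x : completion) : completion :=
  cpi (k *: repr x).

(** Scaling is independent of the representative: [s] and [repr (cpi s)] differ by a null sequence,
    which stays null after scaling. *)
Lemma cpiZ k s : cpi (k *: s) = completion_scale k (cpi s).
Proof.
have h : cseminorm (s - repr (cpi s)) = 0 by apply/cpi_eq; rewrite cpiK.
by apply/cpi_eq; rewrite -scalerBr seminormZ h mulr0.
Qed.

Let completion_scalerA a b v :
  completion_scale a (completion_scale b v) = completion_scale (a * b) v.
Proof. by have [s ->] := cpi_surj v; rewrite -!cpiZ scalerA. Qed.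

Let completion_scale1r : left_id 1 completion_scale.
Proof. by move=> v; have [s ->] := cpi_surj v; rewrite -cpiZ scale1r. Qed.

Let completion_scalerDr : right_distributive completion_scale +%R.
Proof.
move=> a v w; have [s ->] := cpi_surj v; have [t ->] := cpi_surj w.
by rewrite -cpiD -!cpiZ -cpiD scalerDr.
Qed.

Let completion_scalerDl v :
  {morph completion_scale^~ v : a b / a + b}.
Proof. by move=> a b; have [s ->] := cpi_surj v; rewrite -!cpiZ -cpiD scalerDl. Qed.

HB.instance Definition _ := GRing.Zmodule_isLmodule.Build R[i] completion
  completion_scalerA completion_scale1r completion_scalerDr completion_scalerDl.

Lemma cpi_scale k s : cpi (k *: s) = k *: cpi s.
Proof. exact: cpiZ. Qed.

Definition completion_norm (x : completion) : R[i] := (cseminorm (repr x))%:C.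

Lemma completion_norm_pi s : completion_norm (cpi s) = (cseminorm s)%:C.
Proof. by rewrite /completion_norm cseminorm_repr. Qed.

Let completion_normD x y :
  completion_norm (x + y) <= completion_norm x + completion_norm y.
Proof.
have [s ->] := cpi_surj x; have [t ->] := cpi_surj y.
rewrite -cpiD !completion_norm_pi -rmorphD lecR.
exact: seminormD.
Qed.

Let completion_normZ (k : R[i]) x :
  completion_norm (k *: x) = `|k| * completion_norm x.
Proof.
have [s ->] := cpi_surj x; rewrite -cpi_scale !completion_norm_pi seminormZ.
by rewrite rmorphM/= rnormE.
Qed.

Let completion_norm0_eq0 x : completion_norm x = 0 -> x = 0.
Proof.
have [s ->] := cpi_surj x; rewrite completion_norm_pi => /complexI x0.
have -> : 0 = cpi 0 by rewrite [RHS]raddf0.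
by apply/cpi_eq; rewrite subr0.
Qed.

HB.instance Definition _ := Lmodule_isNormed.Build R[i] completion
  completion_normD completion_normZ completion_norm0_eq0.

Lemma rnorm_cpi s : rnorm (cpi s) = cseminorm s.
Proof. by apply: (@complexI R); rewrite rnormE -completion_norm_pi. Qed.

Lemma const_cauchy_sequence (x : E) : (fun=> x) \in cauchy_sequence.
Proof. by apply/asboolP => e e0; exists 0%N => m n _ _; rewrite subrr seminorm0. Qed.

Definition to_completion (x : E) : completion :=
  cpi (CauchySeq (const_cauchy_sequence x)).

Let to_completion_linear : linear to_completion.
Proof.
move=> k x y; rewrite /to_completion -cpi_scale -cpiD; congr cpi.
exact/val_inj.
Qed.

HB.instance Definition _ :=
  GRing.isLinear.Build R[i] E completion *:%R to_completion to_completion_linear.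

Lemma rnorm_to_completion x : rnorm (to_completion x) = p x.
Proof. by rewrite rnorm_cpi; apply: cvg_lim => //; exact: (cvg_cst (p x)). Qed.

(** The terms of a Cauchy sequence, embedded as constant sequences, converge to its class; density
    and completeness both rest on this. *)
Lemma to_completion_approx (s : cauchy_seqs) (e : R) : 0 < e ->
  exists N, forall n, (N <= n)%N -> rnorm (cpi s - to_completion (s n)) <= e.
Proof.
move=> e0; have [N sN] := cseqP s e0; exists N => n Nn.
rewrite /to_completion -cpiB rnorm_cpi; apply: cnorm_le; exists N => m Nm.
by rewrite ltW// [X in p X](_ : _ = s m - s n)// sN.
Qed.

Lemma to_completion_dense_rnorm (x : completion) (e : R) : 0 < e ->
  exists y, rnorm (x - to_completion y) < e.
Proof.
move=> e0; have [s ->] := cpi_surj x.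
have [N sN] := to_completion_approx s (divr_gt0 e0 (ltr0n R 2)).
exists (s N); rewrite (le_lt_trans (sN _ (leqnn N)))//.
by rewrite ltr_pdivrMr// ltr_pMr// ltr1n.
Qed.

Lemma to_completion_dense : dense (range to_completion).
Proof.
move=> O [x Ox]; rewrite openE => /(_ _ Ox)/nbhs_ballP[e /= e0 eO].
have er : e = (complex.Re e)%:C by rewrite RRe_real// gtr0_real.
have [y xy] := @to_completion_dense_rnorm x (complex.Re e)
  ltac:(by rewrite -ltcR -er).
exists (to_completion y); split; last by exists y.
by apply: eO; rewrite -ball_normE/= er -rnormE ltcR.
Qed.

(** A Cauchy filter contains balls of radius [1/(n+1)] centred at points of [E]; the centres [s n]
    form a Cauchy sequence, whose class is the limit. *)
Lemma completion_complete (F : set_system completion) :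
  ProperFilter F -> cauchy F -> cvg F.
Proof.
move=> FF /cauchyP Fc.
have pos n : (0 : R) < n.+1%:R^-1 by rewrite invr_gt0 ltr0n.
have /choice[s sF] n : exists y, F (ball (to_completion y) n.+1%:R^-1%:C).
  have h0 := divr_gt0 (pos n) (ltr0n R 2).
  have [x xF] := Fc (n.+1%:R^-1 / 2)%:C ltac:(by rewrite ltcR).
  have [y xy] := to_completion_dense_rnorm x h0.
  exists y; apply: filterS xF => z; rewrite -!ball_normE/= -!rnormE !ltcR => xz.
  rewrite [ltRHS]splitr (_ : _ - z = (to_completion y - x) + (x - z)).
    by rewrite (le_lt_trans (rnormD _ _))// ltrD// /rnorm distrC.
  by rewrite addrA subrK.
have sFz n z : ball (to_completion (s n)) n.+1%:R^-1%:C z ->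
    rnorm (to_completion (s n) - z) < n.+1%:R^-1.
  by rewrite -ball_normE/= -rnormE ltcR.
have sc : s \in cauchy_sequence.
  apply/asboolP => e e0; have [N eN] := inv_succ_lt (divr_gt0 e0 (ltr0n R 2)).
  exists N => m n Nm Nn.
  (* Two members of a proper filter meet, and a common point [z] links the two centres. *)
  have [z [/sFz mz /sFz nz]] := filter_ex (filterI (sF m) (sF n)).
  rewrite -rnorm_to_completion raddfB/=.
  rewrite (_ : _ - _ = (to_completion (s m) - z) + (z - to_completion (s n))).
    rewrite (le_lt_trans (rnormD _ _))// [ltRHS]splitr ltrD//.
      by rewrite (lt_trans mz)// eN.
    by rewrite /rnorm distrC (lt_trans nz)// eN.
  by rewrite addrA subrK.
apply/cvg_ex; exists (cpi (CauchySeq sc)); apply/cvg_ballP => e e0.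
have er : e = (complex.Re e)%:C by rewrite RRe_real// gtr0_real.
have {e0 er} [d d0 ->] : exists2 d : R, 0 < d & e = d%:C.
  by exists (complex.Re e); rewrite // -ltcR -er.
have [N1 h1] := inv_succ_lt (divr_gt0 d0 (ltr0n R 2)).
have [N2 h2] := to_completion_approx (CauchySeq sc) (divr_gt0 d0 (ltr0n R 2)).
pose N := maxn N1 N2; apply: filterS (sF N) => z /sFz Nz.
rewrite -ball_normE/= -rnormE ltcR.
rewrite (_ : _ - z = (cpi (CauchySeq sc) - to_completion (s N)) + (to_completion (s N) - z)).
  rewrite (le_lt_trans (rnormD _ _))// [ltRHS]splitr ler_ltD//.
    by apply: h2; rewrite leq_maxr.
  by rewrite (lt_trans Nz)// h1// leq_maxl.
by rewrite addrA subrK.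
Qed.

HB.instance Definition _ := Uniform_isComplete.Build completion completion_complete.

End Completion.

Lemma local_banach_exists (R : realType) (E : lmodType R[i]) (p : seminorm E) :
  exists (B : completeNormedModType R[i]) (j : {linear E -> B}),
    is_local_banach p j.
Proof.
exists (completion p), (@to_completion _ _ p).
by split; [exact: rnorm_to_completion|exact: to_completion_dense].
Qed.

(** * Extension by density *)

Section RnormNormed.
Variables (R : realType).

Lemma rnormN (V : normedZmodType R[i]) (x : V) : rnorm (- x) = rnorm x.
Proof. by rewrite /rnorm normrN. Qed.

Lemma rnormZ (V : normedModType R[i]) (k : R[i]) (x : V) :
  rnorm (k *: x) = rnorm k * rnorm x.
Proof. by apply: (@complexI R); rewrite rmorphM/= !rnormE normrZ. Qed.

Lemma rnorm_le0 (V : normedZmodType R[i]) (x : V) : rnorm x <= 0 -> x = 0.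
Proof. by rewrite -lecR rnormE normr_le0 => /eqP. Qed.

Lemma rnorm_sum (V : normedZmodType R[i]) I (r : seq I) (P : pred I) (f : I -> V) :
  rnorm (\sum_(i <- r | P i) f i) <= \sum_(i <- r | P i) rnorm (f i).
Proof.
elim/big_rec2: _ => [|i y x _ xy]; first by rewrite rnorm0.
by rewrite (le_trans (rnormD _ _))// lerD2l.
Qed.

Lemma nbhs_rnorm (V : normedModType R[i]) (x : V) (A : set V) :
  nbhs x A <-> exists2 e : R, 0 < e & forall y, rnorm (x - y) < e -> A y.
Proof.
split=> [/nbhs_ballP[e /= e0 eA]|[e e0 eA]].
  have er : e = (complex.Re e)%:C by rewrite RRe_real// gtr0_real.
  exists (complex.Re e); first by rewrite -ltcR -er.
  by move=> y xy; apply: eA; rewrite -ball_normE/= er -rnormE ltcR.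
apply/nbhs_ballP; exists e%:C; first by rewrite /= ltcR.
by move=> y; rewrite -ball_normE/= -rnormE ltcR; exact: eA.
Qed.

Lemma dense_rnorm (V : normedModType R[i]) (A : set V) : dense A ->
  forall x (e : R), 0 < e -> exists2 y, A y & rnorm (x - y) < e.
Proof.
move=> dA x e e0.
have [||y [/interior_subset xy Ay]] := dA ([set y | rnorm (x - y) < e]°).
- by exists x; apply/nbhs_rnorm; exists e.
- exact: open_interior.
- by exists y.
Qed.

Lemma bounded_rnorm_continuous (V W : normedModType R[i]) (u : {linear V -> W})
  (C : R) : (forall x, rnorm (u x) <= C * rnorm x) -> continuous u.
Proof.
move=> uC x A /nbhs_rnorm[e e0 eA]; apply/nbhs_rnorm.
have C0 : 0 < `|C| + 1 by rewrite ltr_wpDl.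
exists (e / (`|C| + 1)); first by rewrite divr_gt0.
move=> y xy; apply: eA; rewrite -raddfB (le_lt_trans (uC _))//.
rewrite (@le_lt_trans _ _ ((`|C| + 1) * rnorm (x - y)))//.
  by rewrite ler_wpM2r ?rnorm_ge0// (le_trans (ler_norm C))// lerDl.
by rewrite mulrC -ltr_pdivlMr.
Qed.

Lemma continuous_rnorm_bounded (V W : normedModType R[i]) (u : {linear V -> W}) :
  continuous u -> exists2 C : R, 0 < C & forall x, rnorm (u x) <= C * rnorm x.
Proof.
move=> /(_ 0) uc.
have /uc/nbhs_rnorm[d d0 du] : nbhs (u 0) [set y | rnorm y < 1].
  by apply/nbhs_rnorm; exists 1 => // y /=; rewrite raddf0 sub0r rnormN.
exists (2 / d) => [|x]; first by rewrite divr_gt0.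
have [x0|x0] := leP (rnorm x) 0.
  by rewrite (rnorm_le0 x0) raddf0 !rnorm0 mulr0.
(* Rescaled to norm [d / 2], [x] falls inside the ball on which [u] has norm below 1; this yields
   the constant [2 / d]. *)
pose k := (d / 2 / rnorm x)%:C.
have k0 : 0 < d / 2 / rnorm x by rewrite !divr_gt0.
have rk : rnorm k = d / 2 / rnorm x.
  by apply: (@complexI R); rewrite rnormE ger0_norm// ler0c ltW.
have /du : rnorm (0 - k *: x) < d.
  rewrite sub0r rnormN rnormZ rk divfK ?gt_eqF//.
  by rewrite ltr_pdivrMr// ltr_pMr// ltr1n.
rewrite /= linearZ/= rnormZ rk => /ltW.
by rewrite -ler_pdivlMl// mulr1 invf_div (invf_div d) mulrC.
Qed.

(* Completeness in terms of sequences; [R[i]] has no canonical structure of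
   complete space in MathComp-Analysis. *)
Definition seq_complete (V : normedZmodType R[i]) : Prop :=
  forall s : nat -> V,
    (forall e, 0 < e -> exists N, forall m n,
      (N <= m)%N -> (N <= n)%N -> rnorm (s m - s n) < e) ->
  exists y, forall e, 0 < e -> exists N, forall n, (N <= n)%N ->
    rnorm (y - s n) < e.

Lemma complete_seq_complete (V : completeNormedModType R[i]) : seq_complete V.
Proof.
move=> s sc.
have /cvg_ex[y sy] : cvgn s.
  apply: cauchy_cvg; apply/cauchyP => e e0.
  have er : e = (complex.Re e)%:C by rewrite RRe_real// gtr0_real.
  have [N sN] := sc (complex.Re e) ltac:(by rewrite -ltcR -er).
  exists (s N), N => // n /= Nn.
  by rewrite -ball_normE/= er -rnormE ltcR sN.
exists y => e e0; have [|N _ yN] := sy [set z | rnorm (y - z) < e].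
  by apply/nbhs_rnorm; exists e.
by exists N => n Nn; exact: yN.
Qed.

(** Real and imaginary part are 1-Lipschitz, so completeness of [R] gives a limit for each; the sum
    of their absolute values bounds the modulus. *)
Lemma complex_seq_complete : seq_complete R[i].
Proof.
have rnormi : rnorm ('i%C : R[i]) = 1.
  by rewrite /rnorm normc_def/= expr0n expr1n add0r sqrtr1.
have normc_real (x : R) : `|x%:C| = `|x|%:C.
  by rewrite normc_def/= expr0n addr0 sqrtr_sqr.
have Re_le (z : R[i]) : `|complex.Re z| <= rnorm z.
  by rewrite -lecR rnormE normc_ge_Re.
(* Up to sign, the imaginary part of [z] is the real part of [z * 'i]. *)
have Im_le (z : R[i]) : `|complex.Im z| <= rnorm z.
  by rewrite -normrN -ReiNIm (le_trans (Re_le _))// rnormM rnormi mulr1.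
have le_ReIm (z : R[i]) : rnorm z <= `|complex.Re z| + `|complex.Im z|.
  rewrite -lecR rnormE {1}[z]complexE (le_trans (ler_normD _ _))//.
  by rewrite rmorphD/= normrM -(rnormE ('i%C : R[i])) rnormi mul1r !normc_real.
move=> s sc.
have lim_part (f : {additive R[i] -> R}) : (forall z, `|f z| <= rnorm z) ->
    exists y, forall e, 0 < e -> exists N, forall n, (N <= n)%N -> `|y - f (s n)| < e.
  move=> f_le; have /cvg_ex[y /cvgrPdist_lt fy] : cvgn (f \o s).
    apply: cauchy_cvg; apply/cauchyP => e e0; have [N sN] := sc e e0.
    exists (f (s N)), N => // n /= Nn.
    by rewrite /ball/= -raddfB (le_lt_trans (f_le _))// sN.
  exists y => e e0; have [N _ yN] := fy e e0.
  by exists N => n Nn; exact: yN.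
have [x xs] := lim_part _ Re_le; have [y ys] := lim_part _ Im_le.
exists (x +i* y) => e e0.
have [N1 h1] := xs (e / 2) ltac:(by rewrite divr_gt0).
have [N2 h2] := ys (e / 2) ltac:(by rewrite divr_gt0).
exists (maxn N1 N2) => n; rewrite geq_max => /andP[n1 n2].
rewrite (le_lt_trans (le_ReIm _))// [ltRHS]splitr raddfB [complex.Im _]raddfB/=.
by rewrite ltrD// (h1, h2).
Qed.

End RnormNormed.

Section Extension.
Variables (R : realType) (E : lmodType R[i]) (B F : normedModType R[i]).
Variables (j : {linear E -> B}) (T : {linear E -> F}) (C : R).
Hypotheses (j_dense : dense (range j)) (F_complete : seq_complete F) (C0 : 0 <= C).
Hypothesis (Tj : forall a, rnorm (T a) <= C * rnorm (j a)).

(** The closure of the set of pairs [(j a, T a)]. It is the graph of the extension: total by density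
    and completeness, single-valued by the bound on [T]. *)
Let graph (x : B) (y : F) := forall e, 0 < e ->
  exists a, rnorm (x - j a) < e /\ rnorm (y - T a) < e.

Let C1 : 0 < 1 + C. Proof. by rewrite ltr_pwDl. Qed.

Let graph_le x y : graph x y -> rnorm y <= C * rnorm x.
Proof.
move=> xy; apply/ler_addgt0Pr => e e0.
(* With [d = e / (1 + C)] the errors add up to [d + C * d = e]. *)
have [a [xa ya]] := xy (e / (1 + C)) ltac:(by rewrite divr_gt0).
rewrite -(subrK (T a) y) (le_trans (rnormD _ _))//.
have ja : rnorm (j a) <= e / (1 + C) + rnorm x.
  rewrite -{1}(subrK x (j a)) (le_trans (rnormD _ _))// lerD2r.
  by rewrite -rnormN opprB ltW.
rewrite (@le_trans _ _ (e / (1 + C) + C * (e / (1 + C) + rnorm x)))//.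
  by apply: lerD; [exact: ltW|rewrite (le_trans (Tj _))// ler_wpM2l].
rewrite mulrDr addrA addrC lerD2l -{1}(mul1r (e / _)) -mulrDl.
by rewrite mulrC divfK// gt_eqF.
Qed.

Let graph_linear k x y x' y' :
  graph x y -> graph x' y' -> graph (k *: x + x') (k *: y + y').
Proof.
move=> xy xy' e e0; have k0 : 0 < rnorm k + 1 by rewrite ltr_wpDl// rnorm_ge0.
have [a [xa ya]] := xy (e / 2 / (rnorm k + 1)) ltac:(by rewrite !divr_gt0).
have [a' [xa' ya']] := xy' (e / 2) ltac:(by rewrite !divr_gt0).
have est (V : normedModType R[i]) (v w v' w' : V) :
    rnorm (v - w) < e / 2 / (rnorm k + 1) -> rnorm (v' - w') < e / 2 ->
    rnorm (k *: v + v' - (k *: w + w')) < e.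
  move=> vw vw'; rewrite opprD addrACA -scalerBr (le_lt_trans (rnormD _ _))//.
  rewrite [ltRHS]splitr rnormZ ler_ltD//.
  move: vw => /ltW; rewrite ler_pdivlMr// mulrC => /(le_trans _); apply.
  by rewrite ler_wpM2r ?rnorm_ge0// lerDl.
exists (k *: a + a'); rewrite (linearP j) (linearP T).
by split; exact: est.
Qed.

Let graph_total x : exists y, graph x y.
Proof.
have /choice[a xa] n : exists a, rnorm (x - j a) < n.+1%:R^-1.
  by have [|_ [a _ <-]] := dense_rnorm j_dense x (e := n.+1%:R^-1); [rewrite invr_gt0|exists a].
have [e e0|y yT] := F_complete (s := T \o a).
  have [N eN] := inv_succ_lt (divr_gt0 (divr_gt0 e0 (ltr0n R 2)) C1).
  exists N => m n Nm Nn /=; rewrite -raddfB (le_lt_trans (Tj _))//.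
  have h : rnorm (j (a m - a n)) <= e / (1 + C).
    rewrite raddfB (_ : _ - _ = (x - j (a n)) - (x - j (a m))); last first.
      by rewrite opprB [RHS]addrC addrA subrK.
    rewrite (le_trans (rnormD _ _))// rnormN.
    rewrite (@le_trans _ _ (e / 2 / (1 + C) + e / 2 / (1 + C)))//.
      by rewrite lerD// ltW// (lt_trans (xa _))// eN.
    by rewrite -mulrDl -splitr.
  rewrite (le_lt_trans (ler_wpM2l C0 h))// mulrCA gtr_pMr//.
  by rewrite ltr_pdivrMr// mul1r ltrDr.
exists y => e e0; have [N1 yN] := yT e e0; have [N2 eN] := inv_succ_lt e0.
exists (a (maxn N1 N2)); split; last by rewrite yN// leq_maxl.
by rewrite (lt_trans (xa _))// eN// leq_maxr.
Qed.

(** By linearity 0 is related to [y' - y], which the norm bound forces to vanish. *)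
Let graph_unique x y y' : graph x y -> graph x y' -> y = y'.
Proof.
move=> xy xy'; have := graph_le (graph_linear (-1) xy xy').
rewrite !scaleN1r [- x + x]addrC subrr rnorm0 mulr0 => /rnorm_le0/eqP.
by rewrite addrC subr_eq0 => /eqP.
Qed.

Lemma dense_extension : exists u : {linear B -> F},
  (forall a, u (j a) = T a) /\ (forall x, rnorm (u x) <= C * rnorm x).
Proof.
have [u ug] := choice graph_total.
have ul : linear u.
  by move=> k x y; apply: graph_unique (ug _) (graph_linear _ (ug _) (ug _)).
pose ulin := GRing.isLinear.Build R[i] B F *:%R u ul.
exists (HB.pack_for {linear B -> F} u ulin); split=> [a|x]; last exact: graph_le.
apply: (graph_unique (ug _)) => e e0; exists a.
by rewrite !subrr !rnorm0.
Qed.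

End Extension.

(** * The seminorms of [A_sigma] *)

Section SeminormTopologyTheory.
Variables (R : realType) (E : lmodType R[i]) (I : Type) (p : I -> seminorm E).

(** On a basic neighbourhood of 0 given by [s] and [e], [q] stays below 1; scaling [x] by
    [e / 2 / M] moves it there. Any positive bound [M] is allowed, so that the case where all
    [p i x] vanish is covered. *)
Lemma continuous_seminorm_bounded (q : seminorm (seminorm_topology p)) :
  continuous q -> exists (s : seq I) (C : R), 0 < C /\
    forall x M, all (fun i => p i x <= M) s -> 0 < M -> q x <= C * M.
Proof.
move=> /(_ 0 [set y | `|y| < 1]) [|s [e [e0 sq]]].
  by apply/nbhs_ballP; exists 1 => //= y; rewrite -ball_normE/= seminorm0 sub0r normrN.
exists s, (2 / e); split; first by rewrite divr_gt0.
move=> x M sM M0; have k0 : 0 < e / 2 / M by rewrite !divr_gt0.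
have rk : rnorm (e / 2 / M)%:C = e / 2 / M.
  by apply: (@complexI R); rewrite rnormE ger0_norm// ler0c ltW.
have : `|q ((e / 2 / M)%:C *: x)| < 1.
  apply: (sq ((e / 2 / M)%:C *: x)); rewrite /sball/=; apply: sub_all sM => i ixM.
  rewrite subr0 seminormZ rk (@le_lt_trans _ _ (e / 2))//.
    by rewrite mulrAC ler_pdivrMr// ler_wpM2l// ltW// divr_gt0.
  by rewrite ltr_pdivrMr// ltr_pMr// ltr1n.
rewrite ger0_norm ?seminorm_ge0// seminormZ rk => /ltW.
by rewrite -ler_pdivlMl// mulr1 invf_div (invf_div e) mulrC.
Qed.

Lemma le_seminorm_continuous (q : seminorm (seminorm_topology p)) i (C : R) :
  (forall x, q x <= C * p i x) -> continuous q.
Proof.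
move=> qp x A /nbhs_ballP[e /= e0 eA].
have C0 : 0 < `|C| + 1 by rewrite ltr_wpDl.
exists [:: i], (e / (`|C| + 1)); split; first by rewrite divr_gt0.
move=> y; rewrite /sball/= andbT => xy; apply: eA; rewrite -ball_normE/=.
rewrite (le_lt_trans (seminorm_dist _ _ _))// seminormB_sym (le_lt_trans (qp _))//.
rewrite (@le_lt_trans _ _ ((`|C| + 1) * p i (y - x)))//.
  by rewrite ler_wpM2r ?seminorm_ge0// (le_trans (ler_norm C))// lerDl.
by rewrite mulrC -ltr_pdivlMr.
Qed.

End SeminormTopologyTheory.

(** * Finiteness of balls and countability of the group *)

Section Words.
Variables (G : groupType) (S : {fset G}).

Lemma finite_words n : finite_set [set g | is_word S g n].
Proof.
elim: n => [|n IHn].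
  apply: (sub_finite_set _ (finite_set1 (1%g : G))) => g [w [/size0nil-> _ ->]].
  by rewrite big_nil.
apply: (sub_finite_set _ (finite_image2 (fun s g => (s * g)%g) (finite_fset S) IHn)).
move=> g [[|s w] [wn wS ->]] //; rewrite big_cons; move: wn => [wn].
exists s; first by apply: wS; rewrite mem_head.
exists (\prod_(s <- w) s)%g => //; exists w; split=> // x xw.
by apply: wS; rewrite inE xw orbT.
Qed.

Hypothesis generating_S : symmetric_generating S.

Lemma is_word_length g : is_word S g (word_length S g).
Proof.
have [_ /(_ g)[w wS gw]] := generating_S; rewrite /word_length.
case: pselect => [h|[]]; first by case: ex_minnP => m /asboolP.
by exists (size w); apply/asboolP; exists w.
Qed.

(** [fset_set] is empty on infinite sets, so finiteness of the balls makes [volume_growth] a genuine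
    count. *)
Lemma finite_word_ball n : finite_set [set g | (word_length S g <= n)%N].
Proof.
apply: (@sub_finite_set _ _ (\bigcup_(k in `I_n.+1) [set g | is_word S g k])).
  by move=> g gn; exists (word_length S g); [rewrite /= ltnS|exact: is_word_length].
by apply: bigcup_finite => [|k _]; [exact: finite_II|exact: finite_words].
Qed.

(** Nuclear representations are indexed by [nat]; the enumeration transports sums over the group to
    series. *)
Lemma exists_enumeration : infinite_set [set: G] ->
  exists e : nat -> G, set_bij [set: nat] [set: G] e.
Proof.
move=> infG; have : countable (\bigcup_n [set g | is_word S g n]).
  by apply: bigcup_countable => // n _; exact/finite_set_countable/finite_words.
rewrite (_ : \bigcup_n _ = [set: G]).
  move=> /eq_card_nat/(_ infG)/card_set_bijP[f].
  rewrite setTT_bijective => -[e fe ef]; exists e.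
  by rewrite setTT_bijective; exists f.
by apply/seteqP; split=> // g _; exists (word_length S g) => //; exact: is_word_length.
Qed.

End Words.

(** * Weighted norms, the basis elements [delta g] and expansion along them *)

Section RapidDecayTheory.
Variables (R : realType) (G : groupType) (S : {fset G}) (sigma : nat -> R).
Hypothesis sigma_ge1 : forall n, 1 <= sigma n.
Local Notation E := (rapid_decay_series S sigma).
Local Notation weight r g := (sigma (word_length S g) `^ r).
Implicit Types (r : {nonneg R}) (a : E) (g : G).

Lemma wseminormE r a : (wseminorm S sigma r a)%:E = wnorm S sigma r%:num a.
Proof. by rewrite fineK// wnorm_fin. Qed.

Lemma sigma_gt0 n : 0 < sigma n.
Proof. exact: lt_le_trans ltr01 (sigma_ge1 n). Qed.

Lemma wseminorm_le r1 r2 a : r1%:num <= r2%:num ->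
  wseminorm S sigma r1 a <= wseminorm S sigma r2 a.
Proof.
move=> r12; rewrite -lee_fin !wseminormE; apply: le_esum => g _.
by rewrite lee_fin ler_wpM2l ?rnorm_ge0// ler_powR.
Qed.

Lemma sum_le_wseminorm r a (s : seq G) : uniq s ->
  \sum_(g <- s) rnorm (a g) * weight r%:num g <= wseminorm S sigma r a.
Proof.
move=> us; rewrite -lee_fin wseminormE -sumEFin; apply: esum_ge.
by exists [set` s]; [split=> //; apply/finite_seqP; exists s|rewrite fsbig_seq].
Qed.

Definition delta_fun g : G -> R[i] := fun h => (h == g)%:R.

Lemma wnorm_delta (x : R) g : wnorm S sigma x (delta_fun g) = (weight x g)%:E.
Proof.
rewrite -[RHS](@esum_set1 _ _ g (fun h => (weight x h)%:E)) ?lee_fin ?powR_ge0//.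
rewrite esum_mkcond; apply: eq_esum => h _; rewrite /delta_fun.
rewrite classical_sets.in_set1; case: eqVneq => [->|_]; first by rewrite /rnorm normr1 mul1r.
by rewrite rnorm0 mul0r.
Qed.

Lemma delta_fun_rapid_decay g : delta_fun g \in rapid_decay S sigma.
Proof. by apply/asboolP => x x0; rewrite wnorm_delta ltry. Qed.

Definition delta g : E := RapidDecaySeries (delta_fun_rapid_decay g).

Lemma wseminorm_delta r g : wseminorm S sigma r (delta g) = weight r%:num g.
Proof. by apply: EFin_inj; rewrite wseminormE wnorm_delta. Qed.

Variable e : nat -> G.
Hypothesis e_bij : set_bij [set: nat] [set: G] e.

Lemma coef_partial_sum a n k :
  (\sum_(0 <= i < n) a (e i) *: delta (e i)) (e k) = if (k < n)%N then a (e k) else 0.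
Proof.
have e_inj : injective e by move=> i j ij; apply: (set_bij_inj e_bij); rewrite ?inE.
elim: n => [|n IHn]; first by rewrite big_geq.
rewrite big_nat_recr//= -[LHS]/((\sum_(0 <= i < n) a (e i) *: delta (e i)) (e k) +
  a (e n) * (e k == e n)%:R).
rewrite IHn (inj_eq e_inj) ltnS [(k <= n)%N]leq_eqVlt; have [->|_] := eqVneq k n.
  by rewrite ltnn mulr1 add0r.
by rewrite mulr0 addr0.
Qed.

(** The norm of the remainder is the tail of the convergent series of weighted coefficients. *)
Lemma partial_sum_cvg r a (eps : R) : 0 < eps -> exists N, forall n, (N <= n)%N ->
  wseminorm S sigma r (a - \sum_(0 <= i < n) a (e i) *: delta (e i)) < eps.
Proof.
move=> eps0; pose f k := (rnorm (a (e k)) * weight r%:num (e k))%:E.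
have f0 k : (0 <= f k)%E by rewrite lee_fin mulr_ge0 ?rnorm_ge0 ?powR_ge0.
have wnormE (b : E) : wnorm S sigma r%:num b =
    (\sum_(k <oo) (rnorm (b (e k)) * weight r%:num (e k))%:E)%E.
  rewrite nneseries_esumT; first exact: reindex_esum e_bij.
  by move=> k; rewrite lee_fin mulr_ge0 ?rnorm_ge0 ?powR_ge0.
(* Subtracting the partial sum kills the first [n] coefficients and leaves the others unchanged. *)
have tail n : wnorm S sigma r%:num (a - \sum_(0 <= i < n) a (e i) *: delta (e i)) =
    (\sum_(n <= k <oo) f k)%E.
  rewrite wnormE (nneseries_split 0 n); last first.
    by move=> k _; rewrite lee_fin mulr_ge0 ?rnorm_ge0 ?powR_ge0.
  rewrite add0n big1_seq ?add0e; last first.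
    move=> k; rewrite mem_index_iota => /andP[_ /andP[_ kn]].
    rewrite -[X in rnorm X]/(a (e k) - (\sum_(0 <= i < n) a (e i) *: delta (e i)) (e k)).
    by rewrite coef_partial_sum kn subrr rnorm0 mul0r.
  apply/congr_lim/funext => m; apply: eq_big_nat => k /andP[nk _].
  rewrite -[X in rnorm X]/(a (e k) - (\sum_(0 <= i < n) a (e i) *: delta (e i)) (e k)).
  by rewrite coef_partial_sum ltnNge nk subr0.
have /fine_cvgP[_] : (\sum_(n <= k <oo) f k)%E @[n --> \oo] --> 0%E.
  by apply: nneseries_tail_cvg => //; rewrite -wnormE -wseminormE ltry.
move=> /cvgrPdist_lt/(_ _ eps0)[N _ h]; exists N => n Nn.
have := h n Nn; rewrite /= sub0r normrN -tail -wseminormE.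
by rewrite (ger0_norm (seminorm_ge0 (wseminorm S sigma r) _)).
Qed.

End RapidDecayTheory.

(** * Nuclearity implies growth *)

Section DualNorm.
Variables (R : realType) (V : normedModType R[i]) (f : {linear V -> (R[i])^o}).

Lemma dual_norm_le (C : R) : 0 <= C -> (forall x, rnorm (f x) <= C * rnorm x) ->
  (dual_norm f <= C%:E)%E.
Proof.
move=> C0 fC; apply: ge_ereal_sup => _ [x /= x1 <-].
by rewrite lee_fin (le_trans (fC x))// ler_piMr.
Qed.

Hypothesis f_cont : continuous f.

Lemma dual_norm_fin_num : dual_norm f \is a fin_num.
Proof.
have [C C0 fC] := continuous_rnorm_bounded f_cont.
rewrite fin_numElt (lt_le_trans (ltNyr 0)) /=; last first.
  apply: ereal_sup_ubound; exists 0; first by rewrite /= rnorm0.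
  by rewrite raddf0 rnorm0.
by rewrite (le_lt_trans (dual_norm_le (ltW C0) fC))// ltry.
Qed.

Lemma rnorm_le_dual_norm x : rnorm (f x) <= fine (dual_norm f) * rnorm x.
Proof.
have [x0|x0] := leP (rnorm x) 0.
  by rewrite (rnorm_le0 x0) raddf0 !rnorm0 mulr0.
rewrite -ler_pdivrMr// -lee_fin fineK ?dual_norm_fin_num//.
have rk : rnorm ((rnorm x)^-1)%:C = (rnorm x)^-1.
  by apply: (@complexI R); rewrite rnormE ger0_norm// ler0c invr_ge0 ltW.
apply: ereal_sup_ubound; exists (((rnorm x)^-1)%:C *: x).
  by rewrite /= rnormZ rk mulVf// gt_eqF.
by rewrite linearZ/= rnormZ rk mulrC.
Qed.

Lemma dual_norm_ge0 : 0 <= fine (dual_norm f).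
Proof.
rewrite -lee_fin fineK ?dual_norm_fin_num//; apply: ereal_sup_ubound.
by exists 0; [rewrite /= rnorm0|rewrite raddf0 rnorm0].
Qed.

End DualNorm.

Section NuclearToGrowth.
Variables (R : realType) (G : groupType) (S : {fset G}) (sigma : nat -> R).
Hypothesis sigma_ge1 : forall n, 1 <= sigma n.
Local Notation E := (A_sigma S sigma).
Local Notation weight r g := (sigma (word_length S g) `^ r).
Local Notation norm := (wseminorm S sigma).

(** The weighted norms increase with the exponent, so finitely many of them are dominated by one,
    whose exponent is the sum of theirs. *)
Lemma continuous_seminorm_le (q : seminorm E) : continuous q ->
  exists (r : {nonneg R}) (C : R), 0 < C /\ forall a, q a <= C * norm r a.
Proof.
move=> /continuous_seminorm_bounded[s [C [C0 qs]]].
have [r rs] : exists r : {nonneg R}, all (fun i : {nonneg R} => i%:num <= r%:num) s.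
  elim: s {qs} => [|i s [r rs]]; first by exists 0%:nng.
  exists (i%:num + r%:num)%:nng; rewrite /=; apply/andP; split; first by rewrite lerDl.
  by apply: sub_all rs => k /= kr; rewrite ler_wpDl.
exists r, C; split=> // a; apply/ler_addgt0Pr => e e0.
(* The slack [e / C] keeps the common bound positive even when [norm r a] is 0. *)
have eC : 0 < e / C by rewrite divr_gt0.
rewrite (_ : C * _ + e = C * (norm r a + e / C)); last first.
  by rewrite mulrDr mulrCA divff ?mulr1 ?gt_eqF.
apply: qs; last by rewrite ltr_wpDl ?seminorm_ge0.
apply: sub_all rs => i ir; rewrite ler_wpDr//; first exact: ltW.
exact: wseminorm_le.
Qed.

Lemma coef_sub_sum (a : E) N (c : nat -> R[i]) (b : nat -> E) g :
  (a - \sum_(k < N) c k *: b k) g = a g - \sum_(k < N) c k * b k g.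
Proof.
rewrite -[LHS]/(a g - (\sum_(k < N) c k *: b k : E) g); congr (_ - _).
exact: (big_morph (fun a : E => a g)).
Qed.

(* Grothendieck-Pietsch: approximating the [y n] of a nuclear representation by
   elements of [E] and reading off the [g]-coordinate of [delta g] bounds the
   inverse weights. *)
Lemma nuclear_summable : nuclear_space E ->
  exists (r : {nonneg R}) (M : R), forall s : seq G, uniq s ->
    \sum_(g <- s) (weight r%:num g)^-1 <= M.
Proof.
(* Exponent 0 makes [p] the plain l1 norm, which dominates single coordinates and finite sums of
   their absolute values. *)
pose z : {nonneg R} := NngNum (lexx (0 : R)); pose p : seminorm E := norm z.
have p_cont : continuous p.
  by apply: (@le_seminorm_continuous _ _ _ _ p z 1) => x; rewrite mul1r.
move=> /(_ p p_cont)[q [q_cont pq [Eq [Ep [jq [jp [u]]]]]]].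
move=> [[jqE _] [jpE jp_dense] u_cont ujq [f [y [f_cont fy_sum fy]]]].
have [r [C [C0 qC]]] := continuous_seminorm_le q_cont.
pose D n := fine (dual_norm (f n)).
have D0 n : 0 <= D n by exact: dual_norm_ge0.
have Dy0 k : 0 <= D k * rnorm (y k) by rewrite mulr_ge0 ?rnorm_ge0.
have fy_fin k : (dual_norm (f k) * (rnorm (y k))%:E = (D k * rnorm (y k))%:E)%E.
  by rewrite EFinM fineK ?dual_norm_fin_num.
have [T T0 DyT] : exists2 T, 0 <= T & forall N, \sum_(k < N) D k * rnorm (y k) <= T.
  move: fy_sum; under eq_eseriesr do rewrite fy_fin.
  move=> fy_sum.
  have Dyn (k : nat) : (0 <= (D k * rnorm (y k))%:E)%E by rewrite lee_fin.
  exists (fine (\sum_(n <oo) (D n * rnorm (y n))%:E)%E) => [|N].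
    by rewrite fine_ge0// nneseries_ge0.
  rewrite -lee_fin fineK ?ge0_fin_numE ?nneseries_ge0// -sumEFin.
  by rewrite -(big_mkord xpredT (fun k => (D k * rnorm (y k))%:E)) nneseries_lim_ge.
(* [2] comes from absorbing an error of 1/2, [C] from [q <= C * norm r], [T] from the nuclear sum,
   and [1] from replacing each [y k] by some [jp (b k)]. *)
exists r, (2 * C * (T + 1)) => s us.
(* As [s] is finite, one truncation index serves all its elements, with error 1/4. *)
have [N Ns] : exists N, forall g, g \in s ->
    rnorm (jp (delta S sigma g) - \sum_(k < N) f k (jq (delta S sigma g)) *: y k) < 4^-1.
  suff [N sN] : exists N, forall n, (N <= n)%N -> forall g, g \in s ->
      rnorm (jp (delta S sigma g) - \sum_(k < n) f k (jq (delta S sigma g)) *: y k) < 4^-1.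
    by exists N; exact: sN.
  elim: s {us} => [|h s [N sN]]; first by exists 0%N.
  have [|N' _ hN'] := fy (jq (delta S sigma h)) [set v | rnorm (jp (delta S sigma h) - v) < 4^-1].
    by rewrite ujq; apply/nbhs_rnorm; exists 4^-1 => //; rewrite invr_gt0.
  exists (maxn N N') => n; rewrite geq_max => /andP[Nn N'n] g.
  rewrite inE => /predU1P[->|]; last exact: sN.
  by have := hN' n N'n; rewrite /= /series/= big_mkord.
pose W := \sum_(g <- s) weight r%:num g.
(* [K] is so large that replacing [y k] by [jp (b k)] costs at most 1/4 for each [delta g] with [g]
   in [s], and at most 1 in the final sum. *)
pose K := 4 * (1 + \sum_(k < N) D k) * (1 + C * W).
have W0 : 0 <= W by apply: sumr_ge0 => g _; rewrite powR_ge0.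
have K0 : 0 < K.
  by rewrite !mulr_gt0// ltr_pwDl// ?sumr_ge0// mulr_ge0// ltW.
have /choice[b yb] k : exists b, rnorm (y k - jp b) < K^-1.
  by have [|_ [b _ <-]] := dense_rnorm jp_dense (y k) (e := K^-1);
    [rewrite invr_gt0|exists b].
(* The [g]-coordinate of [delta g] is 1 and the approximation misses it by at most 1/2, so the
   [g]-coordinates of the [b k] carry at least 1/2; dividing by the weight gives the claim. *)
have coord g : g \in s ->
    (weight r%:num g)^-1 <= 2 * C * \sum_(k < N) D k * rnorm (b k g).
  move=> gs; set w := weight _ g; have w0 : 0 < w by rewrite powR_gt0// sigma_gt0.
  pose c k := f k (jq (delta S sigma g)).
  have cD k : rnorm (c k) <= D k * (C * w).
    apply: le_trans (rnorm_le_dual_norm (f_cont k) _) _; apply: (ler_wpM2l (D0 k)).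
    by rewrite jqE (le_trans (qC _))// wseminorm_delta.
  have wW : w <= W.
    by rewrite /W (big_rem g)//= lerDl sumr_ge0// => h _; rewrite powR_ge0.
  have p_le : p (delta S sigma g - \sum_(k < N) c k *: b k) <= 2^-1.
    rewrite -jpE raddfB/= raddf_sum/=.
    under eq_bigr do rewrite linearZ/=.
    rewrite -[X in rnorm X](subrKA (\sum_(k < N) c k *: y k)).
    rewrite (le_trans (rnormD _ _))// (_ : 2^-1 = 4^-1 + 4^-1 :> R); last by field.
    apply: lerD; first exact: ltW (Ns g gs).
    rewrite -sumrB (le_trans (rnorm_sum _ _ _))//.
    apply: (@le_trans _ _ (\sum_(k < N) D k * (C * w) * K^-1)).
      apply: ler_sum => k _; rewrite -scalerBr rnormZ.
      by apply: ler_pM; rewrite ?rnorm_ge0//; exact: ltW.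
    rewrite -!mulr_suml ler_pdivrMr// /K -!mulrA mulKf// ler_pM//.
    - exact: sumr_ge0.
    - by rewrite mulr_ge0// ltW.
    - by rewrite lerDr.
    - by rewrite (le_trans (ler_wpM2l (ltW C0) wW))// lerDr.
  have /(le_trans)/(_ p_le) : rnorm (1 - \sum_(k < N) c k * b k g) <=
      p (delta S sigma g - \sum_(k < N) c k *: b k).
    have := @sum_le_wseminorm _ _ _ _ z (delta S sigma g - \sum_(k < N) c k *: b k) [:: g] isT.
    rewrite big_seq1 powRr0 mulr1; apply: le_trans.
    by rewrite coef_sub_sum /= /delta_fun eqxx.
  move=> h; have {h} : 1 <= 2^-1 + \sum_(k < N) D k * (C * w) * rnorm (b k g).
    have r1 : rnorm (1 : R[i]) = 1 by rewrite /rnorm normr1.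
    rewrite -{1}r1 -(subrK (\sum_(k < N) c k * b k g) 1) (le_trans (rnormD _ _))//.
    rewrite lerD// (le_trans (rnorm_sum _ _ _))//; apply: ler_sum => k _.
    by rewrite rnormM ler_wpM2r ?rnorm_ge0.
  under eq_bigr do rewrite mulrAC.
  rewrite -mulr_suml => h; rewrite -div1r ler_pdivrMr//.
  by move: h; set X := \sum_(k < N) _; nra.
apply: (@le_trans _ _ (\sum_(g <- s) 2 * C * \sum_(k < N) D k * rnorm (b k g))).
  by rewrite big_seq [leRHS]big_seq; apply: ler_sum => g gs; exact: coord.
(* After exchanging the sums, the inner sum over [g] is at most the l1 norm [p (b k)], hence at most
   [rnorm (y k) + K^-1]. *)
rewrite -mulr_sumr ler_pM2l ?mulr_gt0// exchange_big/=.
apply: (@le_trans _ _ (\sum_(k < N) D k * (rnorm (y k) + K^-1))).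
  apply: ler_sum => k _; rewrite -mulr_sumr ler_wpM2l//.
  rewrite (@le_trans _ _ (p (b k)))//.
    apply: le_trans (sum_le_wseminorm z (b k) us).
    by apply: ler_sum => g _; rewrite powRr0 mulr1.
  rewrite -jpE -[jp (b k)](subrK (y k)) addrC (le_trans (rnormD _ _))// lerD2l.
  by rewrite -rnormN opprB ltW.
under eq_bigr do rewrite mulrDr.
rewrite big_split/=; apply: lerD; first exact: DyT.
rewrite -mulr_suml ler_pdivrMr// mul1r.
rewrite /K; have SD0 : 0 <= \sum_(k < N) D k by exact: sumr_ge0.
have CW0 : 0 <= C * W by rewrite mulr_ge0// ltW.
by nra.
Qed.

(** On the ball of radius [n] every inverse weight is at least the inverse of [sigma n ^ r], which
    bounds the number of elements by [M * sigma n ^ r]. *)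
Lemma summable_growth (r : {nonneg R}) (M : R) :
    (forall n, sigma n <= sigma n.+1) ->
    (forall s : seq G, uniq s -> \sum_(g <- s) (weight r%:num g)^-1 <= M) ->
  preceq (volume_growth R S) sigma.
Proof.
move=> sigma_mono sumM; have sigma_homo := homo_leq (@lexx _ _) (@le_trans _ _) sigma_mono.
have M0 : 0 <= M by have := sumM [::] isT; rewrite big_nil.
pose k := Num.max 1 r%:num; pose c := (Num.truncn M).+1.
exists c, k; split=> // [|n]; first by rewrite le_max lexx.
apply: (@le_trans _ _ (M * sigma n `^ r%:num)).
  rewrite -ler_pdivrMr ?powR_gt0 ?sigma_gt0//.
  rewrite /volume_growth; set B := fset_set _; apply: le_trans (sumM B (fset_uniq _)).
  rewrite -sum1_size natr_sum mulr_suml.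
  rewrite big_seq [leRHS]big_seq; apply: ler_sum => g gB; rewrite mul1r.
  have gn : (word_length S g <= n)%N.
    (* For an infinite ball [fset_set] is empty by default, so it has no member [g]. *)
    have [finB|infB] := pselect (finite_set [set g | (word_length S g <= n)%N]).
      by move: gB; rewrite /B in_fset_set// inE.
    by move: gB; rewrite /B /fset_set; case: pselect.
  rewrite lef_pV2 ?posrE ?powR_gt0 ?sigma_gt0//.
  by rewrite ge0_ler_powR ?nnegrE ?sigma_homo// ltW// sigma_gt0.
apply: ler_pM => //; [exact: powR_ge0|by rewrite ltW// truncnS_gt|].
rewrite (@le_trans _ _ (sigma n `^ k))//; first by rewrite ler_powR// le_max lexx orbT.
rewrite ge0_ler_powR ?nnegrE ?(ltW (sigma_gt0 _ _))//; first by rewrite le_max ler01.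
by apply: sigma_homo; rewrite leq_pmull.
Qed.

End NuclearToGrowth.

(** * Growth implies nuclearity *)

Section Growth.
Variables (R : realType) (sigma : nat -> R).
Hypotheses (sigma_ge1 : forall n, 1 <= sigma n).
Hypothesis sigma_mono : forall n, sigma n <= sigma n.+1.
Hypothesis sigma_submul : almost_submultiplicative sigma.

(** Induction on [c], splitting [(c + 1) * n] as [n + c * n] and taking [eps = 1]: each step squares
    both factors, which only enlarges the exponent. *)
Lemma sigma_dilation_le (c : nat) : exists (C : R) (k : nat),
  0 < C /\ forall n, sigma (c * n)%N <= C * sigma n ^+ k.
Proof.
have s0 n : 0 <= sigma n by rewrite (le_trans ler01).
elim: c => [|c [C [k [C0 IHc]]]].
  exists 1, 1%N; split=> // n; rewrite mul0n expr1 mul1r.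
  exact: (homo_leq (@lexx _ _) (@le_trans _ _) sigma_mono).
have [c0 c00 submul] := sigma_submul ltr01.
exists (c0 * C ^+ 2), (2 + k * 2)%N; split=> [|n]; first by rewrite mulr_gt0// exprn_gt0.
rewrite mulSn (le_trans (submul _ _))// -mulrA -mulrA ler_pM2l//.
rewrite exprD mulrCA exprM -exprMn -[1 + 1]/2%:R !powR_mulrn// ler_pM ?sqr_ge0//.
by rewrite lerXn2r// nnegrE// mulr_ge0 ?exprn_ge0// ltW.
Qed.

(** Dilation costs only a constant and a power, and [sigma >= 1] allows rounding the real exponent
    up to an integer. *)
Lemma preceq_exprn (f : nat -> R) : preceq f sigma ->
  exists (C : R) (K : nat), 0 < C /\ forall n, f n <= C * sigma n ^+ K.
Proof.
move=> [c [k [c1 k1 fk]]]; have [C [K [C0 sC]]] := sigma_dilation_le c.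
have s0 n : 0 <= sigma n by rewrite (le_trans ler01).
pose k' := (Num.truncn k).+1.
exists (c%:R * C ^+ k'), (K * k')%N; split=> [|n].
  by rewrite mulr_gt0 ?ltr0n// exprn_gt0.
rewrite (le_trans (fk n))// -mulrA ler_pM2l ?ltr0n// exprM -exprMn.
apply: (@le_trans _ _ (sigma (c * n)%N `^ k'%:R)).
  by rewrite ler_powR// ltW// truncnS_gt.
rewrite powR_mulrn// lerXn2r// nnegrE// mulr_ge0 ?exprn_ge0// ltW//.
Qed.

End Growth.

(** * Summability of the inverse weights from the growth bounds *)

Lemma sum_inv_sqr_le (R : realType) N : \sum_(n < N) (n.+1%:R ^- 2 : R) <= 2.
Proof.
case: N => [|N]; first by rewrite big_ord0.
(* The sharper bound [2 - 1/(N+1)] makes the induction go through by telescoping. *)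
suff : \sum_(n < N.+1) (n.+1%:R ^- 2 : R) <= 2 - N.+1%:R^-1.
  by move/le_trans; apply; rewrite gerBl invr_ge0.
elim: N => [|N IHN]; first by rewrite big_ord1 expr1n invr1 -[2]/(1 + 1) addrK.
rewrite big_ord_recr/=; set x : R := N.+1%:R in IHN *.
have x0 : 0 < x by rewrite ltr0n.
have -> : N.+2%:R = x + 1 :> R by rewrite /x natr1.
apply: (@le_trans _ _ (2 - x^-1 + (x + 1) ^- 2)); first by rewrite lerD2r.
rewrite -subr_ge0 (_ : _ - _ = (x * (x + 1) ^+ 2)^-1); last first.
  by field; rewrite !gt_eqF// ltr_wpDr.
by rewrite invr_ge0 mulr_ge0 ?sqr_ge0// ltW.
Qed.

(** Sorting by word length: at most [C1 * sigma n ^+ K1] elements have length [n], which uses up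
    [K1] of the exponent; the remaining [K2 * 2] gives a factor at most [C2 ^+ 2 / (n+1)^2]. *)
Lemma summable_inv_sigma (R : realType) (G : groupType) (S : {fset G})
    (sigma : nat -> R) (C1 C2 : R) (K1 K2 : nat) :
    symmetric_generating S -> (forall n, 1 <= sigma n) -> 0 < C1 -> 0 < C2 ->
    (forall n, volume_growth R S n <= C1 * sigma n ^+ K1) ->
    (forall n, 1 + n%:R <= C2 * sigma n ^+ K2) ->
  forall s : seq G, uniq s ->
    \sum_(g <- s) sigma (word_length S g) ^- (K1 + K2 * 2) <= 2 * (C1 * C2 ^+ 2).
Proof.
move=> genS sigma_ge1 C10 C20 vol lin s us; set m := (K1 + _)%N.
have s0 n : 0 < sigma n by rewrite (lt_le_trans ltr01).
pose N := (\max_(g <- s) word_length S g).+1.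
have -> : \sum_(g <- s) sigma (word_length S g) ^- m =
    \sum_(n < N) \sum_(g <- s | word_length S g == n) sigma n ^- m.
  rewrite [RHS](exchange_big_dep xpredT)//= big_seq [RHS]big_seq.
  apply: eq_bigr => g gs; have gN : (word_length S g < N)%N by rewrite ltnS leq_bigmax_seq.
  by rewrite (big_pred1 (Ordinal gN))// => n; rewrite /= -val_eqE eq_sym.
apply: (@le_trans _ _ (\sum_(n < N) (C1 * C2 ^+ 2) * n.+1%:R ^- 2)); last first.
  by rewrite -mulr_sumr mulrC ler_pM2r ?mulr_gt0 ?exprn_gt0// sum_inv_sqr_le.
apply: ler_sum => n _; rewrite big_const_seq iter_addr_0 -[leLHS]mulr_natl.
set k := count _ s.
have kn : k%:R <= C1 * sigma n ^+ K1.
  apply: le_trans (vol n); rewrite ler_nat /volume_growth /k -size_filter.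
  apply: uniq_leq_size; first exact: filter_uniq.
  move=> g; rewrite mem_filter => /andP[/eqP gn _].
  by rewrite in_fset_set ?inE/= ?gn//; exact: finite_word_ball.
rewrite ler_pdivrMr ?exprn_gt0// (le_trans kn)// -!mulrA ler_pM2l//.
rewrite /m exprD exprM.
have h0 : n.+1%:R <= C2 * sigma n ^+ K2 by rewrite -natr1 addrC lin.
have h : n.+1%:R ^+ 2 <= (C2 * sigma n ^+ K2) ^+ 2.
  by rewrite lerXn2r ?nnegrE// (le_trans _ h0).
rewrite (_ : C2 * _ = sigma n ^+ K1 * ((C2 * sigma n ^+ K2) ^+ 2 * n.+1%:R ^- 2)).
  by rewrite ler_peMr ?exprn_ge0 ?(ltW (s0 _))// ler_pdivlMr ?exprn_gt0// mul1r.
by set x := n.+1%:R ^- 2; ring.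
Qed.

(** * Construction of the nuclear representation *)

Section ScaleSeminorm.
Variables (R : realType) (E : lmodType R[i]) (C : R) (p : seminorm E).
Hypothesis C0 : 0 <= C.

Let scaleD x y : C * p (x + y) <= C * p x + C * p y.
Proof. by rewrite -mulrDr ler_wpM2l// seminormD. Qed.

Let scaleZ (a : R[i]) x : C * p (a *: x) = rnorm a * (C * p x).
Proof. by rewrite seminormZ mulrCA. Qed.

Definition scale_seminorm : seminorm E := Seminorm scaleD scaleZ.

End ScaleSeminorm.

Section Coordinate.
Variables (R : realType) (G : groupType) (S : {fset G}) (sigma : nat -> R) (g : G).

Definition coordinate (a : A_sigma S sigma) : (R[i])^o := a g.

Let coordinate_linear : linear coordinate.
Proof. by []. Qed.

HB.instance Definition _ :=
  GRing.isLinear.Build R[i] (A_sigma S sigma) (R[i])^o *:%R coordinate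
    coordinate_linear.

End Coordinate.

Section GrowthToNuclear.
Variables (R : realType) (G : groupType) (S : {fset G}) (sigma : nat -> R).
Hypothesis sigma_ge1 : forall n, 1 <= sigma n.
Local Notation E := (A_sigma S sigma).
Local Notation weight r g := (sigma (word_length S g) `^ r).
Local Notation norm := (wseminorm S sigma).
Variables (e : nat -> G) (m : nat) (M : R).
Hypothesis e_bij : set_bij [set: nat] [set: G] e.
Hypothesis sumM : forall s : seq G, uniq s ->
  \sum_(g <- s) sigma (word_length S g) ^- m <= M.

Let A k := sigma (word_length S (e k)) ^- m.

Let sumA N : \sum_(k < N) A k <= M.
Proof.
rewrite -(big_mkord xpredT A) -(big_map e xpredT (fun g => sigma (word_length S g) ^- m)).
by apply: sumM; rewrite map_inj_uniq ?iota_uniq// => i j ij;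
  apply: (set_bij_inj e_bij); rewrite ?inE.
Qed.

Lemma summable_nuclear : nuclear_space E.
Proof.
move=> p p_cont; have [r [C [C0 pC]]] := continuous_seminorm_le sigma_ge1 p_cont.
have rm0 : 0 <= r%:num + m%:R by rewrite addr_ge0.
(* The surplus exponent [m] supplies the summable factor; scaling by [C] gives [p <= q]. *)
pose r' : {nonneg R} := NngNum rm0.
pose q : seminorm E := scale_seminorm (norm r') (ltW C0).
have pq x : p x <= q x.
  by rewrite (le_trans (pC _))// ler_pM2l// wseminorm_le//= lerDl.
exists q; split=> //; first exact: (@le_seminorm_continuous _ _ _ _ q r' C).
have [Eq [jq jq_local]] := local_banach_exists q.
have [Ep [jp jp_local]] := local_banach_exists p.
have [jqE jq_dense] := jq_local; have [jpE _] := jp_local.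
have [|u [ujq u_le]] := dense_extension (j := jq) (T := jp) (C := 1) jq_dense
  (@complete_seq_complete _ Ep) ler01.
  by move=> a; rewrite mul1r jqE jpE.
(* [B g] bounds the [g]-coordinate with respect to [q], since [q a] is at least [C * weight r' g]
   times its absolute value. *)
pose B g := (C * weight r'%:num g)^-1.
have w0 x g : 0 < weight x g by rewrite powR_gt0// sigma_gt0.
have B0 g : 0 <= B g by rewrite invr_ge0 mulr_ge0 ?powR_ge0// ltW.
have coord_le g a : rnorm (coordinate g a) <= B g * rnorm (jq a).
  rewrite jqE -ler_pdivrMl ?invr_gt0 ?mulr_gt0// invrK mulrC mulrCA ler_pM2l//.
  by have := @sum_le_wseminorm _ _ _ _ r' a [:: g] isT; rewrite big_seq1.
have /choice[f f_spec] k := @dense_extension _ _ _ _ jq (@coordinate _ _ S sigma (e k))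
  (B (e k)) jq_dense (@complex_seq_complete R) (B0 _) (coord_le _).
pose y k := jp (delta S sigma (e k)).
have y_le k : rnorm (y k) <= C * weight r%:num (e k).
  by rewrite jpE (le_trans (pC _))// wseminorm_delta.
(* [C] and the weights of exponent [r] cancel, leaving the inverse weight of exponent [m]. *)
have ABy k : B (e k) * rnorm (y k) <= A k.
  rewrite mulrC -ler_pdivlMr ?invr_gt0 ?mulr_gt0// invrK.
  rewrite (le_trans (y_le k))// mulrCA ler_pM2l// powRD; last first.
    by rewrite (gt_eqF (sigma_gt0 sigma_ge1 _)) implybT.
  rewrite powR_mulrn ?(ltW (sigma_gt0 sigma_ge1 _))// mulrCA mulVf ?mulr1//.
  by rewrite expf_neq0// gt_eqF// sigma_gt0.
exists Eq, Ep, jq, jp, u; split=> //.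
- exact: bounded_rnorm_continuous u_le.
exists f, y; split.
- by move=> k; exact: bounded_rnorm_continuous (f_spec k).2.
- apply: (@le_lt_trans _ _ M%:E); last exact: ltry.
  apply: lime_le.
    apply: is_cvg_nneseries => k _ _; rewrite mule_ge0 ?lee_fin ?rnorm_ge0//.
    by apply: ereal_sup_ubound; exists 0; [rewrite /= rnorm0|rewrite raddf0 rnorm0].
  apply: nearW => N; rewrite big_mkord.
  apply: (@le_trans _ _ (\sum_(k < N) A k)%:E); last by rewrite lee_fin.
  rewrite -sumEFin; apply: lee_sum => k _.
  rewrite (@le_trans _ _ ((B (e k))%:E * (rnorm (y k))%:E)%E)//.
    rewrite lee_wpmul2r ?lee_fin ?rnorm_ge0//.
    exact: dual_norm_le (f_spec k).2.
  by rewrite -EFinM lee_fin.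
(* The partial sums are bounded by [M] uniformly in [n], so convergence need only be checked on the
   dense range of [jq]. *)
pose Sn n x := \sum_(k < n) f k x *: y k.
have M0 : 0 <= M by have := sumM (s := [::]) isT; rewrite big_nil.
have Sn_le n x : rnorm (Sn n x) <= M * rnorm x.
  rewrite (le_trans (rnorm_sum _ _ _))//.
  apply: (@le_trans _ _ ((\sum_(k < n) A k) * rnorm x)).
    rewrite mulr_suml; apply: ler_sum => k _; rewrite rnormZ.
    rewrite (le_trans (ler_wpM2r (rnorm_ge0 _) ((f_spec k).2 x)))//.
    by rewrite mulrAC ler_wpM2r ?rnorm_ge0.
  by rewrite ler_wpM2r ?rnorm_ge0.
have SnB n x z : Sn n (x - z) = Sn n x - Sn n z.
  by rewrite -sumrB; apply: eq_bigr => k _; rewrite raddfB scalerBl.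
move=> x U /nbhs_rnorm[eps eps0 epsU].
have M1 : 0 < 1 + M by rewrite ltr_pwDl.
have eps20 : 0 < eps / 2 by rewrite divr_gt0.
(* [1 + M] bounds the norm of [u - Sn n], so moving from [x] to [jq a] costs at most [eps / 2]. *)
have [|_ [a _ <-] xa] := dense_rnorm jq_dense x (e := eps / 2 / (1 + M)).
  by rewrite divr_gt0.
have [N aN] := partial_sum_cvg e_bij r a (divr_gt0 eps20 C0).
exists N => // n /= Nn; apply: epsU; rewrite /series/= big_mkord -/(Sn n x).
have -> : u x - Sn n x = (u (x - jq a) - Sn n (x - jq a)) + (jp a - Sn n (jq a)).
  by rewrite SnB raddfB/= ujq opprB -[RHS]addrA (addrC (Sn n (jq a) - Sn n x)) !subrKA.
rewrite (le_lt_trans (rnormD _ _))// [ltRHS]splitr ler_ltD//.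
  rewrite (le_trans (rnormD _ _))// rnormN.
  apply: (@le_trans _ _ ((1 + M) * rnorm (x - jq a))).
    by rewrite mulrDl; apply: lerD.
  by rewrite mulrC -ler_pdivlMr// ltW.
pose d k : E := delta S sigma (e k).
(* On [jq a] the error is the image of the remainder of the expansion of [a], which
   [partial_sum_cvg] makes small. *)
have -> : jp a - Sn n (jq a) = jp (a - \sum_(0 <= k < n) a (e k) *: d k).
  rewrite (raddfB jp) (raddf_sum jp) big_mkord; congr (_ - _); apply: eq_bigr => k _.
  by rewrite (f_spec k).1 /= linearZ.
rewrite jpE (le_lt_trans (pC _))// mulrC -ltr_pdivlMr//.
exact: aN.
Qed.

End GrowthToNuclear.

Theorem theorem6p6 (R : realType) (G : groupType) (S : {fset G})
    (sigma : nat -> R)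
    (infinite_G : infinite_set [set: G]%classic)
    (generating_S : symmetric_generating S)
    (growth_sigma : growth_function sigma)
    (submul_sigma : almost_submultiplicative sigma)
    (linear_sigma : preceq (fun n : nat => (1 + n%:R)%R) sigma) :
  nuclear_space (A_sigma S sigma) <-> preceq (volume_growth R S) sigma.
Proof.
have [sigma_ge1 sigma_mono _] := growth_sigma; split.
  move=> /(nuclear_summable sigma_ge1)[r [M sumM]].
  exact: summable_growth sigma_ge1 r M sigma_mono sumM.
move=> /(preceq_exprn sigma_ge1 sigma_mono submul_sigma)[C1 [K1 [C10 vol]]].
have [C2 [K2 [C20 lin]]] :=
  preceq_exprn sigma_ge1 sigma_mono submul_sigma linear_sigma.
have [e e_bij] := exists_enumeration generating_S infinite_G.
apply: (summable_nuclear sigma_ge1 e_bij).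
exact: (summable_inv_sigma generating_S sigma_ge1 C10 C20 vol lin).
Qed.
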